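(* Let $(V,Y,D)$ be a vertex algebra without vacuum. Set $\overline{V}=V\oplus\mathbb{C}\mathbf{1}$, where $\mathbb{C}\mathbf{1}$ is a one-dimensional vector space with a distinguished basis vector $\mathbf{1}$. Define a linear map $\overline{Y}(\cdot,x):\overline{V}\to(\mathrm{End}\,\overline{V})[[x,x^{-1}]]$ by $\overline{Y}(\mathbf{1},x)=1$ (the identity operator on $\overline V$) and $$\overline{Y}(u,x)(v+\lambda\mathbf{1})=Y(u,x)v+\lambda e^{xD}u\qquad\text{for } u,v\in V,\ \lambda\in\mathbb{C}.$$ Then $(\overline{V},\overline{Y},\mathbf{1})$ carries the structure of a vertex algebra with $V$ as a vertex subalgebra without vacuum.
   Context: All vector spaces are over $\mathbb{C}$. $V((x))$ denotes the space of lower truncated formal Laurent series, $\delta(x)=\sum_{n\in\mathbb{Z}}x^n$, and powers $(x\pm y)^n$ are expanded in nonnegative integer powers of the second variable $y$. For a linear map $Y(\cdot,x):V\to\mathrm{Hom}(V,V((x)))\subset(\mathrm{End}\,V)[[x,x^{-1}]]$, $v\mapsto Y(v,x)=\sum_{n\in\mathbb{Z}}v_nx^{-n-1}$, the Jacobi identity is: for all $u,v\in V$, $$x_0^{-1}\delta\left(\tfrac{x_1-x_2}{x_0}\right)Y(u,x_1)Y(v,x_2)-x_0^{-1}\delta\left(\tfrac{x_2-x_1}{-x_0}\right)Y(v,x_2)Y(u,x_1)=x_2^{-1}\delta\left(\tfrac{x_1-x_0}{x_2}\right)Y(Y(u,x_0)v,x_2).$$ A vertex algebra $(V,Y,\mathbf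 1)$ is a vector space with such a map $Y$ and a vector $\mathbf{1}\in V$ (the vacuum) such that $Y(\mathbf 1,x)v=v$, $Y(v,x)\mathbf 1\in V[[x]]$ with $\lim_{x\to0}Y(v,x)\mathbf 1=v$ for all $v\in V$, and the Jacobi identity holds. Its canonical operator is $\mathcal{D}(v)=v_{-2}\mathbf 1$. A vertex algebra without vacuum $(V,Y,D)$ is a vector space with such a map $Y$ and a linear operator $D$ on $V$ such that the Jacobi identity, $Y(Dv,x)=\frac{d}{dx}Y(v,x)$ for $v\in V$, and skew symmetry $Y(u,x)v=e^{xD}Y(v,-x)u$ for $u,v\in V$ hold. Every vertex algebra with its operator $\mathcal D$ is a vertex algebra without vacuum. That $V$ is a vertex subalgebra without vacuum of $\overline V$ means that $V$ is a subspace closed under all products $a_nb$ and under the canonical operator $\mathcal{D}$ of $\overline V$, and that the induced vertex operator map and operator on $V$ are the given $Y$ and $D$. *)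

(* Defs.v *)
From HB Require Import structures.
From mathcomp Require Import all_boot all_order all_algebra.
From mathcomp Require Import complex.
From mathcomp Require Import mathcomp_extra boolp classical_sets functions.
From mathcomp Require Import cardinality fsbigop reals.

Set Implicit Arguments.
Unset Strict Implicit.
Unset Printing Implicit Defensive.

Import Order.TTheory GRing.Theory Num.Theory.

Local Open Scope classical_set_scope.
Local Open Scope ring_scope.

Section FormalCalculus.
Variable R : realType.
Implicit Types V : lmodType R[i].

(* A formal series in one variable with coefficients in X is a function
   f : int -> X, where f n is the coefficient of x^n; a series in x0, x1, x2 is
   a function on int * int * int, indexed by the exponents of x0, x1, x2. *)

Definition const_series V (v : V) : int -> V := fun n => if n == 0 then v else 0.

(* The action on a series f of a series A of operators.  The sum ranges over
   all of int; it is used only when finitely many terms are nonzero, for then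
   \sum_(k \in setT) is the actual sum. *)
Definition act_series V (A : int -> V -> V) (f : int -> V) : int -> V :=
  fun n => \sum_(k \in [set: int]) A k (f (n - k)).

Definition exp_series V (D : V -> V) : int -> V -> V := fun n v =>
  if n is Posz k then (k`!%:R : R[i])^-1 *: iter k D v else 0.

(* The product of a scalar series and a vector-valued one in three variables.
   In the three terms of the Jacobi identity the sum has finite support by the
   lower truncation of vertex operators. *)
Definition scale_series3 V (f : int * int * int -> R[i])
    (F : int * int * int -> V) : int * int * int -> V :=
  fun n => \sum_(p \in [set: int * int * int]) f p *: F (n - p).

Definition int_binomial (n : int) (k : nat) : R[i] :=
  (\prod_(j < k) (n%:~R - j%:R)) / k`!%:R.

(* The coefficient of x^p y^q in (x - y)^n, expanded in nonnegative powers
   of y. *)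
Definition sub_pow (n p q : int) : R[i] :=
  if q is Posz k then
    if p == n - q then (-1) ^+ k * int_binomial n k else 0
  else 0.

(* The coefficient of x^p y^q z^r in z^-1 delta((x - y) / (s z)), that is, in
   the sum over n of s^-n z^(-n-1) (x - y)^n: only n = - r - 1 contributes. *)
Definition delta_frac (s : R[i]) (p q r : int) : R[i] :=
  s ^ (r + 1) * sub_pow (- r - 1) p q.

End FormalCalculus.

Section VertexAlgebras.
Variable R : realType.
Implicit Types V W : lmodType R[i].

(* A vertex operator map is given by its coefficients: Y u v n is the
   coefficient of x^n in Y(u,x)v.  The mode u_n v is thus the coefficient of
   x^(-n-1). *)
Definition mode V (Y : V -> V -> int -> V) (u : V) (n : int) (v : V) : V :=
  Y u v (- n - 1).

Record vertex_operator_map V (Y : V -> V -> int -> V) : Prop := {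
  vo_linearl : forall (v : V) (n : int), linear (fun u => Y u v n);
  vo_linearr : forall (u : V) (n : int), linear (fun v => Y u v n);
  vo_truncated : forall u v : V,
    exists N : int, forall n : int, n < N -> Y u v n = 0
}.

(* Both sides are applied to an arbitrary vector w. *)
Definition jacobi_identity V (Y : V -> V -> int -> V) : Prop :=
  forall (u v w : V) (n : int * int * int),
    scale_series3 (fun '(a, b, c) => delta_frac 1 b c a)
      (fun '(a, b, c) => if a == 0 then Y u (Y v w c) b else 0) n
  - scale_series3 (fun '(a, b, c) => delta_frac (-1) c b a)
      (fun '(a, b, c) => if a == 0 then Y v (Y u w b) c else 0) n
  = scale_series3 (fun '(a, b, c) => delta_frac 1 b a c)
      (fun '(a, b, c) => if b == 0 then Y (Y u v a) w c else 0) n.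

Record vertex_algebra V (Y : V -> V -> int -> V) (one : V) : Prop := {
  va_map : vertex_operator_map Y;
  va_vacuum : forall (v : V) (n : int), Y one v n = const_series v n;
  va_regular : forall (v : V) (n : int), n < 0 -> Y v one n = 0;
  va_creation : forall v : V, Y v one 0 = v;
  va_jacobi : jacobi_identity Y
}.

Definition canonical_operator V (Y : V -> V -> int -> V) (one : V) : V -> V :=
  fun v => mode Y v (-2) one.

Record vertex_algebra_without_vacuum V (Y : V -> V -> int -> V) (D : V -> V) :
    Prop := {
  vawv_map : vertex_operator_map Y;
  vawv_linear : linear D;
  vawv_jacobi : jacobi_identity Y;
  vawv_derivative : forall (v w : V) (n : int),
    Y (D v) w n = (n + 1)%:~R *: Y v w (n + 1);
  vawv_skew : forall (u v : V) (n : int),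
    Y u v n =
      act_series (exp_series D) (fun m => (-1 : R[i]) ^ m *: Y v u m) n
}.

(* The subspace is the image of V under the linear injection iota. *)
Record vertex_subalgebra_without_vacuum
    W (YW : W -> W -> int -> W) (one : W)
    V (Y : V -> V -> int -> V) (D : V -> V) (iota : V -> W) : Prop := {
  sub_linear : linear iota;
  sub_injective : injective iota;
  sub_closed_mode : forall (a b : W) (n : int),
    range iota a -> range iota b -> range iota (mode YW a n b);
  sub_closed_operator : forall a : W,
    range iota a -> range iota (canonical_operator YW one a);
  sub_map : forall (u v : V) (n : int),
    YW (iota u) (iota v) n = iota (Y u v n);
  sub_operator : forall v : V,
    canonical_operator YW one (iota v) = iota (D v)
}.

End VertexAlgebras.

Section VacuumExtension.
Variables (R : realType) (V : lmodType R[i]).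

Definition vac_ext : lmodType R[i] := (V * R[i]^o)%type.

Definition vac_ext_one : vac_ext := (0, 1).

Definition vac_ext_incl (v : V) : vac_ext := (v, 0).

Definition vac_ext_map (Y : V -> V -> int -> V) (D : V -> V)
    (a b : vac_ext) : int -> vac_ext := fun n =>
  vac_ext_incl (Y a.1 b.1 n + b.2 *: exp_series D n a.1)
  + (a.2 : R[i]) *: const_series b n.

(* With linearity in the first argument, the next two equations determine
   vac_ext_map. *)
Lemma vac_ext_map_one (Y : V -> V -> int -> V) (D : V -> V) :
  vertex_operator_map Y -> linear D ->
  forall (b : vac_ext) (n : int),
    vac_ext_map Y D vac_ext_one b n = const_series b n.
Proof.
move=> [Yl _ _] Dl b n; rewrite /vac_ext_map /= scale1r.
have -> : Y 0 b.1 n = 0.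
  have := Yl b.1 n (-1) 0 0.
  by rewrite /= scaler0 addr0 scaleN1r addNr.
have D0 : D 0 = 0 by have := Dl (-1) 0 0; rewrite scaler0 addr0 scaleN1r addNr.
have -> : exp_series D n 0 = 0.
  case: n => //= k; suff -> : iter k D 0 = 0 by rewrite scaler0.
  by elim: k => //= k ->.
by rewrite scaler0 addr0 add0r.
Qed.

Lemma vac_ext_map_incl (Y : V -> V -> int -> V) (D : V -> V)
    (u v : V) (l : R[i]) (n : int) :
  vac_ext_map Y D (vac_ext_incl u)
    (vac_ext_incl v + l *: vac_ext_one) n
  = vac_ext_incl (Y u v n + l *: exp_series D n u).
Proof.
have l2 : (vac_ext_incl v + l *: vac_ext_one).2 = l.
  by rewrite /= add0r; exact: mulr1.
by rewrite /vac_ext_map l2 /= scale0r addr0 scaler0 addr0.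
Qed.

End VacuumExtension.

(* Main.v *)
Require Import Defs.
From HB Require Import structures.
From mathcomp Require Import all_boot all_order all_algebra.
From mathcomp Require Import complex reals.
From mathcomp Require Import classical_sets fsbigop zify ring.

Set Implicit Arguments.
Unset Strict Implicit.
Unset Printing Implicit Defensive.

Import Order.TTheory GRing.Theory Num.Theory.

Local Open Scope ring_scope.

(* The Jacobi identity is linear in each of u, v, w, so on V + C1 it suffices to
   check it for (1, v, w), (u, 1, w), (u, v, 1) and (u, v, w) with u, v, w in V.
   The last case is the hypothesis.  For (1, v, w) the identity is
   x0^-1 delta((x1-x2)/x0) - x0^-1 delta((x2-x1)/(-x0)) = x2^-1 delta((x1-x0)/x2).
   For (u, 1, w) it follows from this one and Y(e^(x0 D)u, x2) = Y(u, x2 + x0).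
   For (u, v, 1) skew symmetry gives
   Y(u, x1)e^(x2 D)v = e^(x2 D)Y(u, x1 - x2)v and
   Y(v, x2)e^(x1 D)u = e^(x2 D)Y(u, -x2 + x1)v, which again reduces the identity
   to the one for delta functions; on coefficients, the substitutions are
   instances of Vandermonde's convolution. *)

(** * Generalized binomial coefficients and the delta function identity *)

Section Binomials.
Variable R : realType.
Local Notation bin n k := (int_binomial R n k).

Lemma int_binomial0 (n : int) : bin n 0 = 1.
Proof. by rewrite /int_binomial big_ord0 divr1. Qed.

Lemma mul_int_binomialS (n : int) (k : nat) :
  k.+1%:R * bin n k.+1 = (n%:~R - k%:R) * bin n k.
Proof.
rewrite /int_binomial big_ord_recr /= factS natrM.
have k0 : k.+1%:R != 0 :> R[i] by rewrite pnatr_eq0.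
have f0 : k`!%:R != 0 :> R[i] by rewrite pnatr_eq0 -lt0n fact_gt0.
by field; rewrite nat1r k0 f0.
Qed.

Lemma int_binomialS (n : int) (k : nat) :
  bin n k.+1 = (k.+1%:R)^-1 * ((n%:~R - k%:R) * bin n k).
Proof. by rewrite -mul_int_binomialS mulKf // pnatr_eq0. Qed.

Lemma int_binomial_nat (m k : nat) : bin m k = 'C(m, k)%:R.
Proof.
elim: k => [|k IH]; first by rewrite int_binomial0 bin0.
rewrite int_binomialS IH; apply: (canLR (mulKf _)); first by rewrite pnatr_eq0.
have [le_km | lt_mk] := leqP k m.
  by rewrite -natrM mul_bin_left natrM natrB.
by rewrite !bin_small ?mulr0 // (ltn_trans lt_mk).
Qed.

(** Negate each of the k factors of the falling product and reverse their order. *)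
Lemma int_binomialN (n : int) (k : nat) :
  (-1) ^+ k * bin n k = bin (k%:Z - 1 - n) k.
Proof.
rewrite /int_binomial mulrA; congr (_ / _).
have -> : (-1) ^+ k = \prod_(i < k) (-1) :> R[i] by rewrite prodr_const card_ord.
rewrite [RHS](reindex_inj rev_ord_inj) -big_split /=.
apply: eq_bigr => i _; rewrite natrB // !rmorphB /= -natr1.
by rewrite -[(Posz k)%:~R]/(k%:R); ring.
Qed.

(** Induction on j: multiply by j + 1 = k + (j + 1 - k), absorb each part into its own binomial, and
    collect (x - k) + (y - (j - k)) = x + y - j. *)
Lemma vandermonde_int_binomial (x y : int) (j : nat) :
  \sum_(k < j.+1) bin x k * bin y (j - k) = bin (x + y) j.
Proof.
elim: j => [|j IH]; first by rewrite big_ord1 !int_binomial0 mulr1.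
apply: (mulfI (_ : j.+1%:R != 0)); first by rewrite pnatr_eq0.
rewrite mul_int_binomialS -IH !mulr_sumr.
transitivity (\sum_(k < j.+2) (k%:R * bin x k * bin y (j.+1 - k)
   + bin x k * ((j.+1 - k)%:R * bin y (j.+1 - k)))).
  apply: eq_bigr => k _; rewrite natrB; last by case: k => /=; lia.
  ring.
rewrite big_split /= big_ord_recl /= mul0r mul0r add0r.
rewrite [X in _ + X]big_ord_recr /= subnn mul0r mulr0 addr0 -big_split /=.
apply: eq_bigr => -[k lk] _ /=; rewrite /bump /= add1n subSS subSn; last by lia.
rewrite !mul_int_binomialS natrB; last by lia.
rewrite rmorphD /=; ring.
Qed.

(* Extending the binomial coefficient by 0 to negative lower indices turns the
   support conditions of the coefficients of delta functions into identities. *)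
Definition zbin (n k : int) : R[i] :=
  if k is Posz k' then int_binomial R n k' else 0.

Definition sgn (n : int) : R[i] := (-1) ^ n.

Lemma sgnD m n : sgn (m + n) = sgn m * sgn n.
Proof. by rewrite /sgn expfzDr // oppr_eq0 oner_eq0. Qed.

Lemma sgnS m : sgn (m + 1) = - sgn m.
Proof. by rewrite sgnD {2}/sgn expr1z mulrN1. Qed.

Lemma sgnN m : sgn (- m) = sgn m.
Proof. by rewrite /sgn !expN1r abszN. Qed.

Lemma sgnMM m : sgn m * sgn m = 1.
Proof. by rewrite -{2}sgnN -sgnD subrr. Qed.

(** With the half difference d given explicitly, sign comparisons become linear goals for [lia]. *)
Lemma sgn_parity (d m n : int) : m = n + d + d -> sgn m = sgn n.
Proof. by move=> ->; rewrite !sgnD -mulrA sgnMM mulr1. Qed.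

Lemma zbinN (n k : int) : sgn k * zbin n k = zbin (k - 1 - n) k.
Proof. by case: k => k /=; rewrite ?mulr0 // int_binomialN. Qed.

(** For k outside 0..m both sides vanish: one by the extension by 0, the other because m is
    natural. *)
Lemma zbin_sym (m : nat) (k : int) : zbin m k = zbin m (m%:Z - k).
Proof.
case: k => k; rewrite /zbin.
  have [le_km | lt_mk] := leqP k m.
    have -> : m%:Z - k%:Z = (m - k)%N by lia.
    by rewrite !int_binomial_nat bin_sub.
  case E : (m%:Z - k%:Z) => [|//]; first by lia.
  by rewrite int_binomial_nat bin_small.
have -> : m%:Z - Negz k = (m + k.+1)%N by lia.
by rewrite int_binomial_nat bin_small // addnS ltnS leq_addr.
Qed.

(* The coefficients of
   x0^-1 delta((x1-x2)/x0) - x0^-1 delta((x2-x1)/(-x0)) = x2^-1 delta((x1-x0)/x2)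
   at x1^a x2^b x0^(-1-a-b). *)
Lemma delta_identity (a b : int) :
  sgn b * zbin (a + b) b - sgn b * zbin (a + b) a
  = zbin (- 1 - a) (- 1 - a - b).
Proof.
(* If a, b >= 0, the left terms cancel by symmetry and the right side vanishes. If exactly one is
   negative, one left term survives and matches the right side by upper negation and symmetry. If
   both are negative, every term is 0. *)
case: a => [m|m]; case: b => [p|p].
- have -> : - 1 - m%:Z - p%:Z = Negz (m + p) by lia.
  rewrite -[m%:Z + p]/((m + p)%N%:Z) [zbin _ p]zbin_sym.
  have -> : (m + p)%N%:Z - p%:Z = m%:Z by lia.
  by rewrite subrr.
- rewrite [zbin _ (Negz _)]/= mulr0 sub0r.
  have -> : m%:Z + Negz p = m%:Z - 1 - p%:Z by lia.
  have -> : - 1 - m%:Z - Negz p = p%:Z - m%:Z by lia.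
  have -> : - 1 - m%:Z = (p%:Z - m%:Z) - 1 - p%:Z by lia.
  rewrite -!zbinN -zbin_sym mulrA -mulNr; congr (_ * _).
  have -> : sgn (Negz p) = - sgn p%:Z.
    by rewrite NegzE sgnN intS addrC sgnS.
  by rewrite mulNr opprK sgnD sgnN.
- rewrite [zbin _ (Negz _)]/= mulr0 subr0.
  have -> : Negz m + p%:Z = p%:Z - 1 - m%:Z by lia.
  rewrite zbinN (_ : p%:Z - 1 - (p%:Z - 1 - m%:Z) = m%:Z); last by lia.
  by rewrite (_ : -1 - Negz m = m%:Z) 1?zbin_sym //; lia.
- rewrite ![zbin _ (Negz _)]/= !mulr0 subr0 (_ : -1 - Negz m = m%:Z); last by lia.
  rewrite (_ : m%:Z - Negz p = (m + p).+1); last by lia.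
  by rewrite /= int_binomial_nat bin_small //; lia.
Qed.

(** The recursion survives the extension by 0: at k = -1 the factor k + 1 is 0. *)
Lemma mul_zbinS (n k : int) :
  (k + 1)%:~R * zbin n (k + 1) = (n - k)%:~R * zbin n k.
Proof.
case: k => [k|[|k]]; last first.
- by rewrite (_ : Negz k.+1 + 1 = Negz k) /= ?mulr0 //; lia.
- by rewrite (_ : Negz 0 + 1 = 0) ?mul0r ?mulr0.
rewrite (_ : k%:Z + 1 = k.+1) /=; last by lia.
by rewrite rmorphB /=; exact: mul_int_binomialS.
Qed.

(** Terms with k > z have a negative lower index, so any cut-off beyond z gives the full
    convolution. *)
Lemma vandermonde_zbin (x y z : int) (N : nat) : z < N ->
  \sum_(k < N) zbin x k * zbin y (z - k%:Z) = zbin (x + y) z.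
Proof.
case: z => z zN; last first.
  apply: big1 => k _; rewrite (_ : Negz z - k%:Z = Negz (z + k)) ?mulr0 //; lia.
have {}zN : (z < N)%N by lia.
rewrite [RHS]/= -vandermonde_int_binomial.
rewrite (big_ord_widen N (fun k => bin x k * bin y (z - k))) // [RHS]big_mkcond.
apply: eq_bigr => k _ /=; case: ltnP => kz.
  by rewrite (_ : z%:Z - k%:Z = (z - k)%N) //; lia.
by rewrite (_ : z%:Z - k%:Z = Negz (k - z.+1)) ?mulr0 //; lia.
Qed.

End Binomials.

(** * Sums of finite support as sums over ordinals *)

Section FiniteSums.

(** Each term of the Jacobi identity is supported on a ray of exponents, which p parametrizes. *)
Lemma fsum_injective (T : choiceType) (V : zmodType) (F : T -> V)
    (p : nat -> T) (N : nat) :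
  injective p -> (forall x, F x != 0 -> exists2 k, (k < N)%N & x = p k) ->
  \sum_(x \in [set: T]) F x = \sum_(k < N) F (p k).
Proof.
move=> pI Fp; rewrite (fsbigE [seq p k | k <- iota 0 N]) /=; first last.
- move=> x _ xp; apply: contraNeq xp => /Fp[k kN ->].
  by rewrite map_f // mem_iota.
- by [].
- by rewrite map_inj_uniq // iota_uniq.
rewrite big_map -(big_mkord xpredT (F \o p)) /index_iota subn0.
by apply: eq_bigl => k; rewrite in_setT.
Qed.

Lemma sum_ord_cutoff (V : zmodType) (F : nat -> V) (M N : nat) :
  (M <= N)%N -> (forall k, (M <= k)%N -> F k = 0) ->
  \sum_(k < N) F k = \sum_(k < M) F k.
Proof.
move=> MN F0; rewrite [RHS](big_ord_widen N F) // [RHS]big_mkcond.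
by apply: eq_bigr => k _; case: ltnP => // /F0.
Qed.

(** Both sides equal the sum of G over all of int, since the support lies in both ranges. *)
Lemma sum_ord_shift (V : zmodType) (G : int -> V) (c : int) (M N N' : nat) :
  (forall i, i < 0 -> G i = 0) -> (forall i, i < c -> G i = 0) ->
  (forall i : int, M%:Z <= i -> G i = 0) -> M%:Z <= N -> M%:Z - c <= N' ->
  \sum_(k < N') G (c + k%:Z) = \sum_(i < N) G i.
Proof.
move=> G0 Gc GM MN MN'.
have Gsupp (x : int) : G x != 0 -> [/\ 0 <= x, c <= x & x < M].
  move=> Gx; split; rewrite ?[_ <= _]leNgt ?[x < M]ltNge; apply: contraNN Gx.
  - by move/G0->.
  - by move/Gc->.
  - by move/GM->.
rewrite -(fsum_injective (F := G) (p := fun k : nat => c + k%:Z)); last 2 first.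
- by move=> i j; lia.
- by move=> x /Gsupp[x0 xc xM]; exists `|x - c|%N; lia.
rewrite -(fsum_injective (F := G) (p := Posz)) //; first by move=> i j; lia.
by move=> x /Gsupp[x0 xc xM]; exists `|x|%N; lia.
Qed.

End FiniteSums.

(** * The Jacobi identity in coefficients, and the cases with u or v the vacuum *)

Section JacobiCoefficients.
Variables (R : realType) (V : lmodType R[i]).
Implicit Types (Y : V -> V -> int -> V) (u v w : V) (n : int).

Local Notation sgn n := (sgn R n).
Local Notation zbin n k := (zbin R n k).

(** [zbin] absorbs the condition q >= 0, leaving a single support condition. *)
Lemma delta_fracE (s : R[i]) (p q r : int) :
  delta_frac s p q r =
  if p == - r - 1 - q then s ^ (r + 1) * (sgn q * zbin (- r - 1) q) else 0.
Proof.
rewrite /delta_frac /sub_pow; case: q => q; last by rewrite /= !mulr0 if_same.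
by case: ifP; rewrite ?mulr0.
Qed.

(* The coefficient of x0^n0 x1^n1 x2^n2 in the difference of the two sides of
   the Jacobi identity for (u, v), applied to w; the three sums are cut off at N
   terms, which changes nothing for large N. *)
Definition jacobi_defect Y u v w (N : nat) (n0 n1 n2 : int) : V :=
  \sum_(k < N) (sgn k * zbin (- n0 - 1) k)
     *: Y u (Y v w (n2 - k%:Z)) (n1 + n0 + 1 + k%:Z)
  - \sum_(k < N) (sgn (n0 + 1) * (sgn k * zbin (- n0 - 1) k))
     *: Y v (Y u w (n1 - k%:Z)) (n2 + n0 + 1 + k%:Z)
  - \sum_(k < N) zbin (- n1 - 1) k
     *: Y (Y u v (n0 - k%:Z)) w (n2 + n1 + 1 + k%:Z).

(** Asking for vanishing at all large N lets instances with different truncation bounds be added. *)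
Definition jacobi_at Y u v w : Prop := forall n0 n1 n2 : int,
  exists M : nat, forall N, (M <= N)%N -> jacobi_defect Y u v w N n0 n1 n2 = 0.

Section VertexOperatorMap.
Variable Y : V -> V -> int -> V.
Hypothesis hY : vertex_operator_map Y.

Lemma vo0l v n : Y 0 v n = 0.
Proof.
have := vo_linearl hY v n (-1) 0 0.
by rewrite /= scaler0 addr0 scaleN1r addNr.
Qed.

Lemma vo0r u n : Y u 0 n = 0.
Proof.
have := vo_linearr hY u n (-1) 0 0.
by rewrite /= scaler0 addr0 scaleN1r addNr.
Qed.

Lemma voDl u u' v n : Y (u + u') v n = Y u v n + Y u' v n.
Proof. by have := vo_linearl hY v n 1 u u'; rewrite /= !scale1r. Qed.

Lemma voDr u v v' n : Y u (v + v') n = Y u v n + Y u v' n.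
Proof. by have := vo_linearr hY u n 1 v v'; rewrite /= !scale1r. Qed.

Lemma voZl a u v n : Y (a *: u) v n = a *: Y u v n.
Proof. by have := vo_linearl hY v n a u 0; rewrite /= !addr0 vo0l addr0. Qed.

Lemma voZr a u v n : Y u (a *: v) n = a *: Y u v n.
Proof. by have := vo_linearr hY u n a v 0; rewrite /= !addr0 vo0r addr0. Qed.

(** In each term the delta function fixes the total degree and the vertex operators miss one
    variable, so one exponent k stays free; lower truncation bounds it. *)
Lemma jacobi_identityE :
  jacobi_identity Y <-> forall u v w, jacobi_at Y u v w.
Proof.
have coefE u v w n0 n1 n2 : exists M : nat, forall N, (M <= N)%N ->
    jacobi_defect Y u v w N n0 n1 n2 =
    scale_series3 (fun '(a, b, c) => delta_frac 1 b c a)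
      (fun '(a, b, c) => if a == 0 then Y u (Y v w c) b else 0) (n0, n1, n2)
    - scale_series3 (fun '(a, b, c) => delta_frac (-1) c b a)
      (fun '(a, b, c) => if a == 0 then Y v (Y u w b) c else 0) (n0, n1, n2)
    - scale_series3 (fun '(a, b, c) => delta_frac 1 b a c)
      (fun '(a, b, c) => if b == 0 then Y (Y u v a) w c else 0) (n0, n1, n2).
  have [T1 trunc1] := vo_truncated hY v w.
  have [T2 trunc2] := vo_truncated hY u w.
  have [T3 trunc3] := vo_truncated hY u v.
  (* For k beyond this bound the inner vertex operator of each of the three terms vanishes. *)
  exists (`|n2 - T1| + `|n1 - T2| + `|n0 - T3|).+1%N => N NM.
  rewrite /jacobi_defect /scale_series3; congr (_ - _ - _); apply/esym.
  - pose p (k : nat) := (n0, - n0 - 1 - k%:Z, k%:Z).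
    rewrite (fsum_injective (p := p) (N := N)).
    + apply: eq_bigr => k _; rewrite /p delta_fracE eqxx exp1rz mul1r /= subrr eqxx.
      by congr (_ *: Y _ _ _); lia.
    + by move=> i j [].
    + move=> [[a b] c]; rewrite delta_fracE /=.
      case: (eqVneq b) => [->|_]; last by rewrite scale0r eqxx.
      case: (eqVneq (n0 - a)) => [/subr0_eq <-|_]; last by rewrite scaler0 eqxx.
      case: c => c nz; last by rewrite /= !mulr0 scale0r eqxx in nz.
      exists c => //; rewrite ltnNge; apply: contraNN nz => Nc.
      by rewrite trunc1 ?vo0r ?scaler0 //; lia.
  - pose p (k : nat) := (n0, k%:Z, - n0 - 1 - k%:Z).
    rewrite (fsum_injective (p := p) (N := N)).
    + apply: eq_bigr => k _; rewrite /p delta_fracE eqxx /= subrr eqxx.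
      by congr (_ *: Y _ _ _); lia.
    + by move=> i j [].
    + move=> [[a b] c]; rewrite delta_fracE /=.
      case: (eqVneq c) => [->|_]; last by rewrite scale0r eqxx.
      case: (eqVneq (n0 - a)) => [/subr0_eq <-|_]; last by rewrite scaler0 eqxx.
      case: b => b nz; last by rewrite /= !mulr0 scale0r eqxx in nz.
      exists b => //; rewrite ltnNge; apply: contraNN nz => Nc.
      by rewrite trunc2 ?vo0r ?scaler0 //; lia.
  - pose p (k : nat) := (k%:Z, n1, - n1 - 1 - k%:Z).
    rewrite (fsum_injective (p := p) (N := N)).
    + apply: eq_bigr => k _; rewrite /p delta_fracE (_ : n1 == _); last by lia.
      (* The upper index here is n1 + k; upper negation removes both k and the sign, leaving -n1 -
         1. *)
      rewrite exp1rz mul1r zbinN /= subrr eqxx.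
      by congr (int_binomial R _ _ *: Y _ _ _); lia.
    + by move=> i j [].
    + move=> [[a b] c]; rewrite delta_fracE /=.
      case: (eqVneq b) => [bE|_]; last by rewrite scale0r eqxx.
      case: (eqVneq (n1 - b)) => [/subr0_eq n1E|_]; last by rewrite scaler0 eqxx.
      case: a bE => a bE nz; last by rewrite /= !mulr0 scale0r eqxx in nz.
      exists a; last by congr (_, _, _); lia.
      rewrite ltnNge; apply: contraNN nz => Nc.
      by rewrite trunc3 ?vo0l ?scaler0 //; lia.
split=> [J u v w n0 n1 n2 | J u v w [[n0 n1] n2]];
  have [M coefM] := coefE u v w n0 n1 n2.
  by exists M => N /coefM ->; rewrite J subrr.
have [M' defect0] := J u v w n0 n1 n2.
apply/eqP; rewrite -subr_eq0 -(coefM (M + M')%N) ?leq_addr //.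
by rewrite defect0 ?leq_addl.
Qed.

Let sub2DD (x y z x' y' z' : V) :
  x - y - z + (x' - y' - z') = x + x' - (y + y') - (z + z').
Proof. by rewrite !opprD addrACA [x - y + _]addrACA. Qed.

Lemma jacobi_defectPl a u u' v w N n0 n1 n2 :
  jacobi_defect Y (u + a *: u') v w N n0 n1 n2 =
  jacobi_defect Y u v w N n0 n1 n2 + a *: jacobi_defect Y u' v w N n0 n1 n2.
Proof.
rewrite /jacobi_defect !scalerBr !scaler_sumr sub2DD -!big_split.
congr (_ - _ - _); apply: eq_bigr => k _ /=;
  by rewrite ?(voDl, voDr, voZl, voZr) scalerDr !scalerA [a * _]mulrC.
Qed.

Lemma jacobi_defectPm a u v v' w N n0 n1 n2 :
  jacobi_defect Y u (v + a *: v') w N n0 n1 n2 =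
  jacobi_defect Y u v w N n0 n1 n2 + a *: jacobi_defect Y u v' w N n0 n1 n2.
Proof.
rewrite /jacobi_defect !scalerBr !scaler_sumr sub2DD -!big_split.
congr (_ - _ - _); apply: eq_bigr => k _ /=;
  by rewrite ?(voDl, voDr, voZl, voZr) scalerDr !scalerA [a * _]mulrC.
Qed.

Lemma jacobi_defectPr a u v w w' N n0 n1 n2 :
  jacobi_defect Y u v (w + a *: w') N n0 n1 n2 =
  jacobi_defect Y u v w N n0 n1 n2 + a *: jacobi_defect Y u v w' N n0 n1 n2.
Proof.
rewrite /jacobi_defect !scalerBr !scaler_sumr sub2DD -!big_split.
congr (_ - _ - _); apply: eq_bigr => k _ /=;
  by rewrite ?(voDl, voDr, voZl, voZr) scalerDr !scalerA [a * _]mulrC.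
Qed.

(** Only k = -p contributes; if -p is negative, both sides are 0 because c vanishes there. *)
Lemma sum_const_series (c : int -> R[i]) (f : int -> V) (p : int) (N : nat) :
  (forall k, k < 0 -> c k = 0) -> - p < N ->
  \sum_(k < N) c k *: const_series (f k) (p + k%:Z) = c (- p) *: f (- p).
Proof.
move=> c0 pN; have [p0 | p0] := ltP (- p) 0.
  rewrite c0 // scale0r; apply: big1 => k _; rewrite /const_series.
  by case: eqP => [?|_]; rewrite ?scaler0 //; lia.
have lt_pN : (`|p| < N)%N by lia.
rewrite (bigD1 (Ordinal lt_pN)) //= big1 => [|k kp].
  rewrite addr0 /const_series (_ : `|p|%N%:Z = - p) ?subrr //; lia.
rewrite /const_series; case: eqP => [pk|_]; rewrite ?scaler0 //.
by case/eqP: kp; apply: val_inj => /=; lia.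
Qed.

Lemma const_seriesB v m n : const_series v (m - n) = const_series v (- m + n).
Proof. by rewrite /const_series -oppr_eq0 opprB addrC. Qed.

Lemma vo_constr u v m n : Y u (const_series v m) n = const_series (Y u v n) m.
Proof. by rewrite /const_series; case: ifP; rewrite ?vo0r. Qed.

Lemma vo_constl u v m n : Y (const_series u m) v n = const_series (Y u v n) m.
Proof. by rewrite /const_series; case: ifP; rewrite ?vo0l. Qed.

(** Each sum collapses to a multiple of Y v w (n0 + n1 + n2 + 1); the coefficients are those of
    [delta_identity] at a = n1, b = -(n1 + n0 + 1). *)
Lemma jacobi_at_vacuuml one v w :
  (forall v n, Y one v n = const_series v n) -> jacobi_at Y one v w.
Proof.
move=> vac n0 n1 n2.
exists (`|n0| + `|n1| + 2)%N => N NM; rewrite /jacobi_defect.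
under eq_bigr do rewrite vac.
rewrite (sum_const_series (c := fun k => sgn k * zbin (- n0 - 1) k)
  (fun k => Y v w (n2 - k)));
  [|by case=> // k _; rewrite mulr0|lia].
under [X in _ - X - _]eq_bigr do rewrite vac vo_constr const_seriesB.
rewrite (sum_const_series
  (c := fun k => sgn (n0 + 1) * (sgn k * zbin (- n0 - 1) k))
  (fun k => Y v w (n2 + n0 + 1 + k)));
  [|by case=> // k _; rewrite !mulr0|lia].
under [X in _ - X]eq_bigr do rewrite vac vo_constl const_seriesB.
rewrite (sum_const_series (c := fun k => zbin (- n1 - 1) k)
  (fun k => Y v w (n2 + n1 + 1 + k)));
  [|by case|lia].
rewrite !opprK (_ : n2 + (n1 + n0 + 1) = n2 + n1 + 1 + n0); last by lia.
rewrite (_ : n2 + n0 + 1 + n1 = n2 + n1 + 1 + n0); last by lia.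
rewrite -!scalerBl mulrA -sgnD (_ : _ - _ = 0) ?scale0r //.
rewrite (@sgn_parity _ (n0 + 1 + n1) _ (- (n1 + n0 + 1))); last by lia.
have := delta_identity R n1 (- (n1 + n0 + 1)).
rewrite (_ : n1 - _ = - n0 - 1); last by lia.
rewrite (_ : - 1 - n1 - - _ = n0); last by lia.
by move=> ->; rewrite [-1 - n1]addrC subrr.
Qed.

(** Taylor's formula Y(e^(x0 D)u, x2) = Y(u, x2 + x0) at x0^j x2^m, by iterating the derivative
    property. *)
Lemma mode_exp_series D u w (j m : int) : linear D ->
  (forall u w n, Y (D u) w n = (n + 1)%:~R *: Y u w (n + 1)) ->
  Y (exp_series D j u) w m = zbin (m + j) j *: Y u w (m + j).
Proof.
move=> Dl der; case: j => [j|j]; last by rewrite /= vo0l scale0r.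
elim: j m => [|j IH] m.
  by rewrite /= invr1 !scale1r addr0 int_binomial0 scale1r.
have -> : exp_series D j.+1 u = j.+1%:R^-1 *: D (exp_series D j u).
  rewrite /= -[_ *: iter j D u]addr0 Dl.
  have -> : D 0 = 0 by have := Dl (-1) 0 0; rewrite scaler0 addr0 scaleN1r addNr.
  by rewrite addr0 scalerA factS natrM invfM.
rewrite voZl der IH !scalerA (_ : m + 1 + j = m + j.+1); last by lia.
congr (_ *: _); rewrite -mulrA [RHS]int_binomialS; congr (_ * (_ * _)).
by rewrite -[j%:R]/(j%:Z%:~R) -rmorphB /=; congr _%:~R; lia.
Qed.

(** The first two sums collapse; the third is summed by Taylor's formula and Vandermonde. What
    remains is [delta_identity] at a = -(n2 + n0 + 1), b = n2. *)
Lemma jacobi_at_vacuumm D one u w : linear D ->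
  (forall v n, Y one v n = const_series v n) ->
  (forall n, Y u one n = exp_series D n u) ->
  (forall u w n, Y (D u) w n = (n + 1)%:~R *: Y u w (n + 1)) ->
  jacobi_at Y u one w.
Proof.
move=> Dl vac creat der n0 n1 n2.
exists (`|n0| + `|n2| + 2)%N => N NM; rewrite /jacobi_defect.
under eq_bigr do rewrite vac vo_constr const_seriesB.
rewrite (sum_const_series (c := fun k => sgn k * zbin (- n0 - 1) k)
  (fun k => Y u w (n1 + n0 + 1 + k)));
  [|by case=> // k _; rewrite mulr0|lia].
under [X in _ - X - _]eq_bigr do rewrite vac.
rewrite (sum_const_series
  (c := fun k => sgn (n0 + 1) * (sgn k * zbin (- n0 - 1) k))
  (fun k => Y u w (n1 - k)));
  [|by case=> // k _; rewrite !mulr0|lia].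
pose S := n2 + n1 + 1 + n0.
have modeS (k : nat) : n2 + n1 + 1 + k%:Z + (n0 - k%:Z) = S by rewrite /S; lia.
under [X in _ - X]eq_bigr => k _ do
  rewrite creat (mode_exp_series _ _ _ _ Dl der) modeS scalerA.
rewrite -scaler_suml vandermonde_zbin; last by lia.
rewrite !opprK (_ : n1 + n0 + 1 + n2 = S); last by rewrite /S; lia.
rewrite (_ : n1 + (n2 + n0 + 1) = S); last by rewrite /S; lia.
rewrite -!scalerBl mulrA -sgnD (_ : _ - _ = 0) ?scale0r //.
rewrite (@sgn_parity _ (- n2) (n0 + 1 - (n2 + n0 + 1)) n2); last by lia.
have := delta_identity R (- (n2 + n0 + 1)) n2.
rewrite (_ : - _ + n2 = - n0 - 1); last by lia.
rewrite (_ : - 1 - - _ = n2 + n0); last by lia.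
rewrite (_ : n2 + n0 - n2 = n0); last by lia.
rewrite (_ : - n1 - 1 + S = n2 + n0); last by rewrite /S; lia.
by move=> ->; rewrite subrr.
Qed.

End VertexOperatorMap.
End JacobiCoefficients.

(** * The operator series e^(xD) *)

Section ExpSeries.
Variables (R : realType) (V : lmodType R[i]) (D : V -> V).
Hypothesis Dl : linear D.

Lemma operator0 : D 0 = 0.
Proof. by have := Dl (-1) 0 0; rewrite scaler0 addr0 scaleN1r addNr. Qed.

Lemma operatorZ a v : D (a *: v) = a *: D v.
Proof. by have := Dl a v 0; rewrite !addr0 operator0 addr0. Qed.

Lemma operatorD u v : D (u + v) = D u + D v.
Proof. by have := Dl 1 u v; rewrite !scale1r. Qed.

Lemma exp_series_linear n : linear (exp_series D n).
Proof.
case: n => [n|n] a u v /=; last by rewrite scaler0 addr0.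
rewrite scalerA mulrC -scalerA -scalerDr; congr (_ *: _).
by elim: n => //= n ->; exact: Dl.
Qed.

Lemma exp_series0 n : exp_series D n 0 = 0.
Proof.
by have := exp_series_linear n (-1) 0 0; rewrite scaler0 addr0 scaleN1r addNr.
Qed.

Lemma exp_seriesZ n a v : exp_series D n (a *: v) = a *: exp_series D n v.
Proof.
by have := exp_series_linear n a v 0; rewrite !addr0 exp_series0 addr0.
Qed.

(** This is D e^(xD) = d/dx e^(xD); at n = -1 the factor n + 1 is 0. *)
Lemma operator_exp_series n v :
  D (exp_series D n v) = (n + 1)%:~R *: exp_series D (n + 1) v.
Proof.
case: n => [n|[|n]].
- have -> : n%:Z + 1 = n.+1 by lia.
  rewrite /= operatorZ factS natrM invfM scalerA mulrA -[n.+1%:~R]/(n.+1%:R).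
  by rewrite divff ?mul1r // pnatr_eq0.
- by rewrite (_ : Negz 0 + 1 = 0) // scale0r /= operator0.
- by rewrite (_ : Negz n.+1 + 1 = Negz n) /= ?operator0 ?scaler0 //; lia.
Qed.

Lemma exp_series_operator n v :
  exp_series D n (D v) = (n + 1)%:~R *: exp_series D (n + 1) v.
Proof.
rewrite -operator_exp_series; case: n => n /=; last by rewrite operator0.
by rewrite operatorZ -iterSr.
Qed.

Lemma act_exp_series (f : int -> V) (T n : int) (N : nat) :
  (forall m, m < T -> f m = 0) -> n - T < N ->
  act_series (exp_series D) f n = \sum_(k < N) exp_series D k (f (n - k%:Z)).
Proof.
move=> fT nT; rewrite /act_series (fsum_injective (p := Posz) (N := N)) //.
  by move=> i j [].
case=> k; last by rewrite eqxx.
move=> nz; exists k => //; rewrite ltnNge; apply: contraNN nz => Nk.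
by rewrite fT ?exp_series0 //; lia.
Qed.

End ExpSeries.

(** * Consequences of skew symmetry *)

Section WithoutVacuum.
Variables (R : realType) (V : lmodType R[i]).
Variables (Y : V -> V -> int -> V) (D : V -> V).
Hypothesis hV : vertex_algebra_without_vacuum Y D.

Local Notation sgn n := (sgn R n).
Local Notation zbin n k := (zbin R n k).
Let hY := vawv_map hV.
Let Dl := vawv_linear hV.

Lemma skew_symmetry_sum u v (T n : int) (N : nat) :
  (forall m, m < T -> Y v u m = 0) -> n - T < N ->
  Y u v n = \sum_(k < N) sgn (n - k%:Z) *: exp_series D k (Y v u (n - k%:Z)).
Proof.
move=> trunc NT; rewrite (vawv_skew hV) (act_exp_series Dl (T := T) (N := N)) //.
  by apply: eq_bigr => k _; rewrite exp_seriesZ.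
by move=> m mT; rewrite trunc ?scaler0.
Qed.

(** Skew symmetry gives Y(u,x)Dv = e^(xD) Y(Dv,-x)u; the derivative property and the product rule
    for e^(xD) Y(v,-x)u then yield [D, Y(u,x)] = d/dx Y(u,x). *)
Lemma mode_operator u v n :
  Y u (D v) n = D (Y u v n) - (n + 1)%:~R *: Y u v (n + 1).
Proof.
have [T trunc] := vo_truncated hY v u.
pose N := `|n - T|.+2%N.
have truncD m : m < T - 1 -> Y (D v) u m = 0.
  by move=> mT; rewrite (vawv_derivative hV) trunc ?scaler0 //; lia.
rewrite (skew_symmetry_sum (N := N.+1) truncD); last by lia.
rewrite (skew_symmetry_sum (n := n) (N := N) trunc); last by lia.
rewrite (skew_symmetry_sum (n := n + 1) (N := N.+1) trunc); last by lia.
rewrite (big_morph D (operatorD Dl) (operator0 Dl)).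
(* Applying D shifts k to k + 1; the added term k = 0 carries the factor 0. *)
have -> : \sum_(k < N) D (sgn (n - k%:Z) *: exp_series D k (Y v u (n - k%:Z)))
  = \sum_(k < N.+1) (k%:R * sgn (n + 1 - k%:Z))
      *: exp_series D k (Y v u (n + 1 - k%:Z)).
  rewrite [RHS]big_ord_recl mul0r scale0r add0r; apply: eq_bigr => k _.
  rewrite operatorZ // operator_exp_series // scalerA mulrC lift0.
  rewrite (_ : n + 1 - k.+1%:Z = n - k%:Z); last by lia.
  by rewrite (_ : k%:Z + 1 = k.+1) //; lia.
rewrite scaler_sumr -sumrB; apply: eq_bigr => k _.
rewrite (vawv_derivative hV) exp_seriesZ // !scalerA -scalerBl.
rewrite (_ : n - k%:Z + 1 = n + 1 - k%:Z); last by lia.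
congr (_ *: _); rewrite (_ : n + 1 - k%:Z = n - k%:Z + 1); last by lia.
rewrite sgnS !rmorphD rmorphN /= -[(Posz k)%:~R]/(k%:R).
ring.
Qed.

(** The coefficient of x1^p x2^q in Y(u, x1)e^(x2 D)v = e^(x2 D)Y(u, x1 - x2)v, by induction on q
    through [mode_operator]. *)
Lemma mode_exp_series_r u v (q p : int) (N : nat) : q < N ->
  Y u (exp_series D q v) p =
  \sum_(i < N) (sgn (q - i%:Z) * zbin (p + q - i%:Z) (q - i%:Z))
     *: exp_series D i (Y u v (p + q - i%:Z)).
Proof.
case: q => [q|q] qN; last first.
  rewrite /= vo0r // big1 // => i _.
  by rewrite (_ : Negz q - i%:Z = Negz (q + i)) /= ?mulr0 ?scale0r //; lia.
pose F i := (sgn (q%:Z - i%:Z) * zbin (p + q%:Z - i%:Z) (q%:Z - i%:Z))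
  *: exp_series D i (Y u v (p + q%:Z - i%:Z)).
rewrite [RHS](sum_ord_cutoff (F := F) (M := q.+1)) /F; first last.
- move=> k qk; rewrite (_ : q%:Z - k%:Z = Negz (k - q.+1)) ?mulr0 ?scale0r //.
  by lia.
- by lia.
elim: q p {N qN F} => [|q IH] p.
  rewrite big_ord1 /= subrr addr0 int_binomial0 mulr1 [sgn 0]expr0z.
  by rewrite !invr1 !scale1r subr0.
have q1 : q.+1%:R != 0 :> R[i] by rewrite pnatr_eq0.
apply: (scalerI q1); rewrite -voZr //.
have -> : q.+1%:R *: exp_series D q.+1 v = D (exp_series D q v).
  by rewrite operator_exp_series // (_ : q%:Z + 1 = q.+1) //; lia.
rewrite mode_operator !IH (big_morph D (operatorD Dl) (operator0 Dl)).
rewrite !scaler_sumr.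
pose P := p + q.+1%:Z; pose E i := exp_series D i (Y u v (P - i)).
(* Both sums are extended to i < q + 2 by a zero term, so that the coefficients of [E i] can be
   compared. *)
rewrite [X in _ - X](_ : _ = \sum_(i < q.+2)
   ((p + 1)%:~R * (sgn (q%:Z - i%:Z) * zbin (P - i%:Z) (q%:Z - i%:Z)))
     *: E i); last first.
  rewrite [RHS]big_ord_recr /= (_ : q%:Z - q.+1%:Z = Negz 0) /=; last by lia.
  rewrite !mulr0 scale0r addr0; apply: eq_bigr => i _.
  by rewrite scalerA /E (_ : p + 1 + q%:Z = P) //; rewrite /P; lia.
rewrite [X in X - _](_ : _ = \sum_(i < q.+2)
   (i%:R * (sgn (q.+1%:Z - i%:Z) * zbin (P - i%:Z) (q.+1%:Z - i%:Z)))
     *: E i); last first.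
  rewrite [RHS]big_ord_recl mul0r scale0r add0r; apply: eq_bigr => i _.
  rewrite operatorZ // operator_exp_series // scalerA mulrC lift0 /E.
  rewrite (_ : P - i.+1%:Z = p + q%:Z - i%:Z); last by rewrite /P; lia.
  rewrite (_ : q.+1%:Z - i.+1%:Z = q%:Z - i%:Z); last by lia.
  by rewrite (_ : i%:Z + 1 = i.+1) //; lia.
rewrite -sumrB; apply: eq_bigr => i _.
rewrite -scalerBl [RHS]scalerA; congr (_ *: _).
rewrite -/P (_ : q.+1%:Z - i%:Z = q%:Z - i%:Z + 1); last by lia.
have := mul_zbinS R (P - i%:Z) (q%:Z - i%:Z).
rewrite (_ : P - i%:Z - (q%:Z - i%:Z) = p + 1); last by rewrite /P; lia.
rewrite sgnS => zbinS.
(* The part i matches the sum coming from D; the part q - i + 1 becomes p + 1 by [zbinS]. *)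
rewrite (_ : q.+1%:R = i%:R + (q%:Z - i%:Z + 1)%:~R); last first.
  rewrite -[i%:R]/(i%:Z%:~R) -rmorphD /= -[q.+1%:R]/(q.+1%:Z%:~R).
  by congr _%:~R; lia.
rewrite [RHS]mulrDl [X in _ = _ + X]mulrCA zbinS.
ring.
Qed.

(** Skew symmetry followed by Taylor's formula: Y(v, x2)e^(x1 D)u = e^(x2 D)Y(e^(x1 D)u, -x2)v. The
    power x1^q lowers the truncation bound from T to T - q. *)
Lemma mode_exp_series_skew u v (T q p : int) (N : nat) :
  (forall m, m < T -> Y u v m = 0) -> p + q - T < N ->
  Y v (exp_series D q u) p =
  \sum_(i < N) (sgn (p - i%:Z) * zbin (p + q - i%:Z) q)
     *: exp_series D i (Y u v (p + q - i%:Z)).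
Proof.
move=> trunc pqN; rewrite (skew_symmetry_sum (T := T - q) (N := N)).
- apply: eq_bigr => i _.
  rewrite (mode_exp_series hY _ _ _ _ Dl (vawv_derivative hV)).
  by rewrite exp_seriesZ // scalerA (_ : p - i%:Z + q = p + q - i%:Z) //; lia.
- move=> m mT; rewrite (mode_exp_series hY _ _ _ _ Dl (vawv_derivative hV)).
  by rewrite trunc ?scaler0 //; lia.
- by lia.
Qed.

(* The Jacobi identity for (u, v, 1).  Every term is rewritten in the vectors
   D^i/i! (Y u v (S - i)); their coefficients are the three terms of
   delta_identity at a = n1, b = n2 - i. *)
Lemma jacobi_creation u v (n0 n1 n2 : int) :
  exists M : nat, forall N, (M <= N)%N ->
  \sum_(k < N) (sgn k * zbin (- n0 - 1) k)
     *: Y u (exp_series D (n2 - k%:Z) v) (n1 + n0 + 1 + k%:Z)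
  - \sum_(k < N) (sgn (n0 + 1) * (sgn k * zbin (- n0 - 1) k))
     *: Y v (exp_series D (n1 - k%:Z) u) (n2 + n0 + 1 + k%:Z)
  - \sum_(k < N) zbin (- n1 - 1) k
     *: exp_series D (n2 + n1 + 1 + k%:Z) (Y u v (n0 - k%:Z)) = 0.
Proof.
have [T trunc] := vo_truncated hY u v.
pose S : int := n0 + n1 + n2 + 1; pose E i := exp_series D i (Y u v (S - i)).
exists (`|S - T| + `|n2| + `|n1| + `|(n2 + n1 + 1)%R| + 1)%N => N NM.
have -> : \sum_(k < N) (sgn k * zbin (- n0 - 1) k)
     *: Y u (exp_series D (n2 - k%:Z) v) (n1 + n0 + 1 + k%:Z)
  = \sum_(i < N) (sgn (n2 - i%:Z) * zbin (n1 + n2 - i%:Z) (n2 - i%:Z)) *: E i.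
  have n2N (k : nat) : n2 - k%:Z < N by lia.
  under eq_bigr do rewrite (mode_exp_series_r _ _ _ (n2N _)) scaler_sumr.
  rewrite exchange_big; apply: eq_bigr => i _ /=.
  (* After the interchange, the sum over k is Vandermonde's with upper indices -n0 - 1 and S - i. *)
  rewrite (_ : n1 + n2 - i%:Z = - n0 - 1 + (S - i%:Z)); last by rewrite /S; lia.
  rewrite -(@vandermonde_zbin R _ _ _ N); last by lia.
  rewrite mulr_sumr scaler_suml; apply: eq_bigr => k _.
  rewrite (_ : n1 + n0 + 1 + k%:Z + (n2 - k%:Z) = S); last by rewrite /S; lia.
  rewrite scalerA (_ : n2 - k%:Z - i%:Z = n2 - i%:Z - k%:Z); last by lia.
  congr (_ *: _); rewrite mulrACA -sgnD (_ : k%:Z + _ = n2 - i%:Z) //; lia.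
have -> : \sum_(k < N) (sgn (n0 + 1) * (sgn k * zbin (- n0 - 1) k))
     *: Y v (exp_series D (n1 - k%:Z) u) (n2 + n0 + 1 + k%:Z)
  = \sum_(i < N) (sgn (n2 - i%:Z) * zbin (n1 + n2 - i%:Z) n1) *: E i.
  have STN (k : nat) : n2 + n0 + 1 + k%:Z + (n1 - k%:Z) - T < N.
    by rewrite /S in NM; lia.
  under eq_bigr do rewrite (mode_exp_series_skew trunc (STN _)) scaler_sumr.
  rewrite exchange_big; apply: eq_bigr => i _ /=.
  rewrite (_ : n1 + n2 - i%:Z = - n0 - 1 + (S - i%:Z)); last by rewrite /S; lia.
  rewrite -(@vandermonde_zbin R _ _ _ N); last by lia.
  rewrite mulr_sumr scaler_suml; apply: eq_bigr => k _.
  rewrite (_ : n2 + n0 + 1 + k%:Z + (n1 - k%:Z) = S); last by rewrite /S; lia.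
  rewrite scalerA [sgn (n0 + 1) * _]mulrA mulrACA -!sgnD; congr (_ * _ *: _).
  by apply: (@sgn_parity _ (n0 + 1 + k%:Z)); lia.
have -> : \sum_(k < N) zbin (- n1 - 1) k
     *: exp_series D (n2 + n1 + 1 + k%:Z) (Y u v (n0 - k%:Z))
  = \sum_(i < N) zbin (- n1 - 1) (i%:Z - (n2 + n1 + 1)) *: E i.
  pose G i := zbin (- n1 - 1) (i - (n2 + n1 + 1)) *: E i.
  (* Reindexing by i = n2 + n1 + 1 + k is harmless: [G] vanishes for i < 0 by [exp_series], for i <
     n2 + n1 + 1 by [zbin], and for i > S - T by truncation. *)
  transitivity (\sum_(k < N) G (n2 + n1 + 1 + k%:Z)); last first.
    apply: (sum_ord_shift (M := `|S - T|.+1)).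
    - by case=> // i _; rewrite /G /E /= scaler0.
    - move=> i ic; have : i - (n2 + n1 + 1) < 0 by lia.
      by rewrite /G; case: (i - _) => // j _; rewrite scale0r.
    - move=> i iS; rewrite /G /E trunc ?exp_series0 ?scaler0 //; lia.
    - by lia.
    - by lia.
  apply: eq_bigr => k _; rewrite /G /E.
  rewrite (_ : S - (n2 + n1 + 1 + k%:Z) = n0 - k%:Z); last by rewrite /S; lia.
  by rewrite (_ : n2 + n1 + 1 + k%:Z - (n2 + n1 + 1) = k) //; lia.
rewrite -!sumrB big1 // => i _; rewrite -!scalerBl (_ : _ - _ = 0) ?scale0r //.
rewrite [n1 + n2 - i%:Z](_ : _ = n1 + (n2 - i%:Z)); last by lia.
rewrite delta_identity [-1 - n1]addrC.
by rewrite (_ : - n1 - 1 - (n2 - i%:Z) = i%:Z - (n2 + n1 + 1)) ?subrr //; lia.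
Qed.

End WithoutVacuum.

(** * The vertex algebra structure on V + C1 *)

Section VacuumExtension.
Variables (R : realType) (V : lmodType R[i]).
Variables (Y : V -> V -> int -> V) (D : V -> V).
Hypothesis hV : vertex_algebra_without_vacuum Y D.

Let hY := vawv_map hV.
Let Dl := vawv_linear hV.
Local Notation one := (vac_ext_one V).
Local Notation incl := (@vac_ext_incl R V).
Local Notation Yext := (vac_ext_map Y D).

Lemma vac_ext_split (a : vac_ext V) : a = incl a.1 + (a.2 : R[i]) *: one.
Proof.
case: a => a b; congr (_, _) => /=; first by rewrite scaler0 addr0.
by rewrite add0r; exact/esym/mulr1.
Qed.

Lemma vac_ext_incl_linear : linear incl.
Proof. by move=> a u v; congr (_, _) => /=; rewrite scaler0 addr0. Qed.

Lemma vac_ext_inclD u v : incl (u + v) = incl u + incl v.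
Proof. by congr (_, _); rewrite /= addr0. Qed.

Lemma vac_ext_inclB u v : incl (u - v) = incl u - incl v.
Proof. by congr (_, _); rewrite /= subr0. Qed.

Lemma vac_ext_inclZ a u : incl (a *: u) = a *: incl u.
Proof. by congr (_, _); rewrite /= scaler0. Qed.

Lemma vac_ext_map_incl_incl u v n : Yext (incl u) (incl v) n = incl (Y u v n).
Proof. by rewrite /vac_ext_map /= !scale0r !addr0. Qed.

Lemma vac_ext_map_one_r a n :
  Yext a one n = incl (exp_series D n a.1) + (a.2 : R[i]) *: const_series one n.
Proof. by rewrite /vac_ext_map /= vo0r // add0r scale1r. Qed.

Lemma vac_ext_vertex_operator_map : vertex_operator_map Yext.
Proof.
split.
- move=> b n a u u'; rewrite /vac_ext_map.
  have -> : Y (a *: u + u').1 b.1 n + b.2 *: exp_series D n (a *: u + u').1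
    = a *: (Y u.1 b.1 n + b.2 *: exp_series D n u.1)
      + (Y u'.1 b.1 n + b.2 *: exp_series D n u'.1).
    rewrite (vo_linearl hY) exp_series_linear // [b.2 *: (_ + _)]scalerDr.
    by rewrite !scalerDr !scalerA [a * _]mulrC addrACA.
  rewrite vac_ext_incl_linear -[(a *: u + u').2]/(a * u.2 + u'.2) scalerDl.
  by rewrite -scalerA addrACA -scalerDr.
- move=> u n a b b'; rewrite /vac_ext_map.
  have -> : Y u.1 (a *: b + b').1 n + (a *: b + b').2 *: exp_series D n u.1
    = a *: (Y u.1 b.1 n + b.2 *: exp_series D n u.1)
      + (Y u.1 b'.1 n + b'.2 *: exp_series D n u.1).
    rewrite (vo_linearr hY) -[(a *: b + b').2]/(a * b.2 + b'.2) scalerDl -scalerA.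
    by rewrite addrACA -scalerDr.
  have -> : const_series (a *: b + b') n =
      a *: const_series b n + const_series b' n.
    by rewrite /const_series; case: ifP; rewrite ?scaler0 ?addr0.
  rewrite vac_ext_incl_linear [_.2 *: (_ + _)]scalerDr [a *: (_ + _)]scalerDr.
  by rewrite !scalerA [a * _]mulrC addrACA.
- move=> u v; have [N trunc] := vo_truncated hY u.1 v.1.
  (* The exponential and constant series have no negative powers, hence the bound 0. *)
  exists (Num.min N 0) => n; rewrite lt_min => /andP[nN n0].
  rewrite /vac_ext_map trunc // /const_series lt_eqF // !scaler0.
  by case: n n0 {nN} => // n _; rewrite /= scaler0 !addr0.
Qed.

Lemma vac_ext_map_operator (u b : vac_ext V) n :
  Yext (incl (D u.1)) b n = (n + 1)%:~R *: Yext u b (n + 1).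
Proof.
rewrite /vac_ext_map /= scale0r addr0 (vawv_derivative hV) exp_series_operator //.
rewrite [_ *: (_ + _)]scalerDr -vac_ext_inclZ scalerDr !scalerA [_ * b.2]mulrC.
(* The vacuum component of u acts by a constant series, whose derivative is 0. *)
suff -> : ((n + 1)%:~R * (u.2 : R[i])) *: const_series b (n + 1) = 0.
  by rewrite addr0.
by rewrite /const_series; case: eqP => [->|_]; rewrite ?mul0r ?scale0r ?scaler0.
Qed.

Lemma jacobi_at_incl u v w : jacobi_at Yext (incl u) (incl v) (incl w).
Proof.
have /(jacobi_identityE hY) J := vawv_jacobi hV.
move=> n0 n1 n2; have [M defect0] := J u v w n0 n1 n2.
exists M => N /defect0; rewrite /jacobi_defect.
move=> /(congr1 incl) /(etrans _); apply.
rewrite !vac_ext_inclB.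
rewrite !(big_morph incl vac_ext_inclD (erefl : incl 0 = 0)).
congr (_ - _ - _); apply: eq_bigr => k _;
  by rewrite vac_ext_inclZ !vac_ext_map_incl_incl.
Qed.

(** Since Y(x, z)1 = e^(zD)x for x in V, the defect is the image of the expression in
    [jacobi_creation]. *)
Lemma jacobi_at_incl_one u v : jacobi_at Yext (incl u) (incl v) one.
Proof.
move=> n0 n1 n2; have [M defect0] := jacobi_creation hV u v n0 n1 n2.
exists M => N /defect0; rewrite /jacobi_defect.
move=> /(congr1 incl) /(etrans _); apply.
rewrite !vac_ext_inclB.
rewrite !(big_morph incl vac_ext_inclD (erefl : incl 0 = 0)).
have creation x n : Yext (incl x) one n = incl (exp_series D n x).
  by rewrite vac_ext_map_one_r scale0r addr0.
congr (_ - _ - _); apply: eq_bigr => k _;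
  by rewrite vac_ext_inclZ ?(creation, vac_ext_map_incl_incl).
Qed.

Lemma jacobi_at_incl_one_mid u c : jacobi_at Yext (incl u) one c.
Proof.
(* The extension of D that annihilates the vacuum. *)
pose Dext (a : vac_ext V) := incl (D a.1).
have Dext_linear : linear Dext.
  by move=> a x y; rewrite /Dext Dl vac_ext_incl_linear.
apply: (jacobi_at_vacuumm vac_ext_vertex_operator_map c Dext_linear).
- exact: vac_ext_map_one.
- move=> n; rewrite vac_ext_map_one_r scale0r addr0.
  case: n => // n; rewrite /exp_series vac_ext_inclZ; congr (_ *: _).
  by elim: n => //= n <-.
- exact: vac_ext_map_operator.
Qed.

Lemma vac_ext_jacobi : jacobi_identity Yext.
Proof.
have hYext := vac_ext_vertex_operator_map.
apply/(jacobi_identityE hYext) => a b c n0 n1 n2.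
have vac := vac_ext_map_one hY Dl.
have [M1 J1] := jacobi_at_vacuuml hYext b c vac n0 n1 n2.
have [M2 J2] := jacobi_at_incl_one_mid a.1 c n0 n1 n2.
have [M3 J3] := jacobi_at_incl_one a.1 b.1 n0 n1 n2.
have [M4 J4] := jacobi_at_incl a.1 b.1 c.1 n0 n1 n2.
exists (M1 + M2 + M3 + M4)%N => N NM.
(* The slots are split from left to right: [J1] and [J2] allow arbitrary entries to the right of the
   vacuum, so each vacuum part drops out at once. *)
rewrite (vac_ext_split a) (jacobi_defectPl hYext) J1 ?scaler0 ?addr0; last by lia.
rewrite (vac_ext_split b) (jacobi_defectPm hYext) J2 ?scaler0 ?addr0; last by lia.
rewrite (vac_ext_split c) (jacobi_defectPr hYext) J3 ?scaler0 ?addr0; last by lia.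
by rewrite J4 //; lia.
Qed.

Lemma vac_ext_vertex_algebra : vertex_algebra Yext one.
Proof.
split.
- exact: vac_ext_vertex_operator_map.
- exact: vac_ext_map_one.
- move=> a n n0; rewrite vac_ext_map_one_r /const_series lt_eqF // scaler0 addr0.
  by case: n n0.
- move=> a; rewrite vac_ext_map_one_r /= invr1 scale1r /const_series eqxx.
  exact/esym/vac_ext_split.
- exact: vac_ext_jacobi.
Qed.

Lemma vac_ext_canonical_operator (a : vac_ext V) :
  canonical_operator Yext one a = incl (D a.1).
Proof.
(* The mode -2 is the coefficient of x^1, where the constant series vanishes. *)
rewrite /canonical_operator /mode vac_ext_map_one_r (_ : - -2 - 1 = 1) //.
by rewrite /const_series /= invr1 scale1r scaler0 addr0.
Qed.

Lemma vac_ext_vertex_subalgebra_without_vacuum :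
  vertex_subalgebra_without_vacuum Yext one Y D incl.
Proof.
split.
- exact: vac_ext_incl_linear.
- by move=> u v [].
- move=> _ _ n [u _ <-] [v _ <-]; exists (mode Y u n v) => //.
  by rewrite /mode vac_ext_map_incl_incl.
- by move=> _ [u _ <-]; exists (D u); rewrite // vac_ext_canonical_operator.
- exact: vac_ext_map_incl_incl.
- by move=> v; rewrite vac_ext_canonical_operator.
Qed.

End VacuumExtension.

Theorem theorem2p8 (R : realType) (V : lmodType R[i])
    (Y : V -> V -> int -> V) (D : V -> V)
    (hV : vertex_algebra_without_vacuum Y D) :
  vertex_algebra (vac_ext_map Y D) (vac_ext_one V) /\
  vertex_subalgebra_without_vacuum (vac_ext_map Y D) (vac_ext_one V)
    Y D (@vac_ext_incl R V).
Proof.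
split; first exact: vac_ext_vertex_algebra.
exact: vac_ext_vertex_subalgebra_without_vacuum.
Qed.
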